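(* Let $(X,T)$ be a minimal flow on a compact Hausdorff space $X$ admitting a $T$-invariant (Borel) probability measure. Then for every $x\in X$ the set $V(x)$ is dense in $RP(x)$. Moreover, if $X$ is metrizable, then $V=RP$ (and hence $V$ equals the equicontinuous structure relation $S_{eq}$).
   Context: $X$ compact Hausdorff, $T$ a topological group acting continuously on $X$; minimal means every orbit is dense. Regionally proximal relation: $(x,y)\in RP$ iff there are nets $\{x_i\},\{y_i\}\subset X$, $\{t_i\}\subset T$ and $z\in X$ with $x_i\to x$, $y_i\to y$, $t_ix_i\to z$, $t_iy_i\to z$. Veech relation: $(x,y)\in V$ iff there are $z\in X$ and a net $\{t_i\}\subset T$ with $t_ix\to z$ and $t_i^{-1}z\to y$. For a relation $R$, $R(x)=\{y:(x,y)\in R\}$. The equicontinuous structure relation $S_{eq}$ is the smallest closed $T$-invariant equivalence relation on $X$ such that the quotient flow $X/S_{eq}$ is equicontinuous. *)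

(* Defs.v *)
From Stdlib Require Import Reals List.
Open Scope R_scope.
Set Implicit Arguments.

Record topology (X : Type) := Topology {
  open : (X -> Prop) -> Prop;
  open_full : open (fun _ => True);
  open_inter : forall U V, open U -> open V -> open (fun x => U x /\ V x);
  open_union : forall F : (X -> Prop) -> Prop,
      (forall U, F U -> open U) -> open (fun x => exists U, F U /\ U x)
}.
Arguments open {X} t U.

Definition prod_open {X Y : Type} (tX : topology X) (tY : topology Y)
  (W : X -> Y -> Prop) : Prop :=
  forall a b, W a b -> exists U V, open tX U /\ open tY V /\ U a /\ V b /\
    (forall x y, U x -> V y -> W x y).

Definition closed {X : Type} (tX : topology X) (C : X -> Prop) : Prop :=
  open tX (fun x => ~ C x).

Definition closure {X : Type} (tX : topology X) (A : X -> Prop) (y : X) : Prop :=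
  forall U, open tX U -> U y -> exists a, A a /\ U a.

Definition compact {X : Type} (tX : topology X) : Prop :=
  forall (I : Type) (U : I -> X -> Prop),
    (forall i, open tX (U i)) -> (forall x, exists i, U i x) ->
    exists l : list I, forall x, exists i, In i l /\ U i x.

Definition hausdorff {X : Type} (tX : topology X) : Prop :=
  forall x y, x <> y -> exists U V, open tX U /\ open tX V /\ U x /\ V y /\
    (forall z, U z -> V z -> False).

Definition metrizable {X : Type} (tX : topology X) : Prop :=
  exists d : X -> X -> R,
    (forall x y, 0 <= d x y) /\ (forall x y, d x y = 0 <-> x = y) /\
    (forall x y, d x y = d y x) /\ (forall x y z, d x z <= d x y + d y z) /\
    (forall U, open tX U <->
       forall x, U x -> exists eps, 0 < eps /\ forall y, d x y < eps -> U y).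

Record directed := Directed {
  dir_car :> Type;
  dir_le : dir_car -> dir_car -> Prop;
  dir_refl : forall i, dir_le i i;
  dir_trans : forall i j k, dir_le i j -> dir_le j k -> dir_le i k;
  dir_up : forall i j, exists k, dir_le i k /\ dir_le j k;
  dir_inhab : inhabited dir_car
}.

Definition net_conv {X : Type} (tX : topology X) {D : directed}
  (f : D -> X) (x : X) : Prop :=
  forall U, open tX U -> U x ->
    exists i0 : D, forall i, dir_le D i0 i -> U (f i).

Record TopGroup := {
  tg_car :> Type;
  tg_mul : tg_car -> tg_car -> tg_car;
  tg_inv : tg_car -> tg_car;
  tg_one : tg_car;
  tg_assoc : forall a b c, tg_mul a (tg_mul b c) = tg_mul (tg_mul a b) c;
  tg_mul1 : forall a, tg_mul tg_one a = a;
  tg_mulV : forall a, tg_mul (tg_inv a) a = tg_one;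
  tg_top : topology tg_car;
  tg_mul_cont : forall U, open tg_top U ->
      prod_open tg_top tg_top (fun a b => U (tg_mul a b));
  tg_inv_cont : forall U, open tg_top U -> open tg_top (fun a => U (tg_inv a))
}.

Record Flow (T : TopGroup) := {
  fl_car :> Type;
  fl_top : topology fl_car;
  act : tg_car T -> fl_car -> fl_car;
  act_one : forall x, act (tg_one T) x = x;
  act_mul : forall s t x, act (tg_mul T s t) x = act s (act t x);
  act_cont : forall U, open fl_top U ->
      prod_open (tg_top T) fl_top (fun t x => U (act t x));
  fl_compact : compact fl_top;
  fl_hausdorff : hausdorff fl_top
}.
Arguments fl_top {T} f.
Arguments act {T} f t x.

Section FlowDefs.
Variable T : TopGroup.
Variable X : Flow T.

Definition minimal : Prop :=
  forall x y, closure (fl_top X) (fun z => exists t, z = act X t x) y.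

Definition sigma_algebra (S : (X -> Prop) -> Prop) : Prop :=
  S (fun _ => True) /\
  (forall A, S A -> S (fun x => ~ A x)) /\
  (forall A : nat -> X -> Prop, (forall n, S (A n)) -> S (fun x => exists n, A n x)).

Definition borel (A : X -> Prop) : Prop :=
  forall S, sigma_algebra S -> (forall U, open (fl_top X) U -> S U) -> S A.

Definition invariant_borel_prob (mu : (X -> Prop) -> R) : Prop :=
  (forall A, borel A -> 0 <= mu A) /\
  mu (fun _ => True) = 1 /\
  (forall A : nat -> X -> Prop, (forall n, borel (A n)) ->
     (forall n m x, n <> m -> A n x -> A m x -> False) ->
     infinite_sum (fun n => mu (A n)) (mu (fun x => exists n, A n x))) /\
  (forall (t : tg_car T) A, borel A -> mu (fun x => A (act X t x)) = mu A).

Definition RP (x y : X) : Prop :=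
  exists (D : directed) (xi yi : D -> X) (ti : D -> tg_car T) (z : X),
    net_conv (fl_top X) xi x /\ net_conv (fl_top X) yi y /\
    net_conv (fl_top X) (fun i => act X (ti i) (xi i)) z /\
    net_conv (fl_top X) (fun i => act X (ti i) (yi i)) z.

Definition Veech (x y : X) : Prop :=
  exists (D : directed) (ti : D -> tg_car T) (z : X),
    net_conv (fl_top X) (fun i => act X (ti i) x) z /\
    net_conv (fl_top X) (fun i => act X (tg_inv T (ti i)) z) y.

(* For an equivalence relation Rl on X, the open sets of the quotient X/Rl
   correspond to the Rl-saturated open sets of X; the open neighbourhoods of
   the diagonal of X/Rl x X/Rl (product of quotient topologies) correspond to
   the following subsets of X x X. *)
Definition sat_open (Rl : X -> X -> Prop) (U : X -> Prop) : Prop :=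
  open (fl_top X) U /\ (forall x y, Rl x y -> U x -> U y).

Definition quot_diag_nbhd (Rl : X -> X -> Prop) (W : X -> X -> Prop) : Prop :=
  (forall x y, Rl x y -> W x y) /\
  (forall a b, W a b -> exists U V, sat_open Rl U /\ sat_open Rl V /\ U a /\ V b /\
     (forall x y, U x -> V y -> W x y)).

(* The quotient flow X/Rl (compact Hausdorff, uniformity = neighbourhoods of the
   diagonal) is equicontinuous. *)
Definition quotient_equicontinuous (Rl : X -> X -> Prop) : Prop :=
  forall W, quot_diag_nbhd Rl W ->
    exists W', quot_diag_nbhd Rl W' /\
      forall t x y, W' x y -> W (act X t x) (act X t y).

Definition closed_invariant_equivalence (Rl : X -> X -> Prop) : Prop :=
  (forall x, Rl x x) /\ (forall x y, Rl x y -> Rl y x) /\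
  (forall x y z, Rl x y -> Rl y z -> Rl x z) /\
  prod_open (fl_top X) (fl_top X) (fun x y => ~ Rl x y) /\
  (forall t x y, Rl x y -> Rl (act X t x) (act X t y)).

Definition S_eq (x y : X) : Prop :=
  forall Rl, closed_invariant_equivalence Rl -> quotient_equicontinuous Rl -> Rl x y.
End FlowDefs.

(* Main.v *)
From Stdlib Require Import Reals Lra Lia List Classical ClassicalEpsilon.
From Stdlib Require Import FunctionalExtensionality PropExtensionality.
Require Import Defs.

(* Let [B] be an open neighbourhood of [y] and [N] the orbit closure of [{x} x B] in
   [X x X].  Upper semicontinuity and minimality make the measure of the fibers
   [N u] constant, so the measure of [N u \/ N v] minus this constant is a continuous
   invariant pseudometric.  It vanishes at [(x, y)] whenever [RP x y] or [S_eq x y];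
   since invariant measures on minimal flows have full support, [B] is then contained in
   [N y], i.e. [(y, y)] is in [N], and by minimality every nonempty open [A] admits a [t]
   such that [t x] is in [A] and [t B] meets [A].  Iterating this along shrinking sets [A]
   gives [t_n] and a cluster point [z] of [t_n x] with [t_n^-1 z] in [B] for all [n]; hence
   some point of the closure of [B] is Veech related to [x].  With a metric, [B] may
   shrink to [y] along the way. *)

(** * Extensionality, choice and directed index sets *)

Lemma pred_ext {X : Type} (U V : X -> Prop) : (forall x, U x <-> V x) -> U = V.
Proof.
  intros H; apply functional_extensionality; intros x.
  apply propositional_extensionality, H.
Qed.

(* [ClassicalChoice.choice] would rest on additional axioms. *)
Lemma choice {A B : Type} (P : A -> B -> Prop) :
  (forall a, exists b, P a b) -> exists f, forall a, P a (f a).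
Proof.
  intros H; exists (fun a => proj1_sig (constructive_indefinite_description _ (H a))).
  intros a; apply proj2_sig.
Qed.

Definition nat_directed : directed :=
  @Directed nat le le_n Nat.le_trans
    (fun i j => ex_intro _ (Nat.max i j) (conj (Nat.le_max_l i j) (Nat.le_max_r i j)))
    (inhabits O).

Definition prod_directed (D E : directed) : directed.
Proof.
  refine (@Directed (D * E)
            (fun p q => dir_le D (fst p) (fst q) /\ dir_le E (snd p) (snd q)) _ _ _ _).
  - intros p; split; apply dir_refl.
  - intros p q r [] []; split; eapply dir_trans; eauto.
  - intros [i i'] [j j']; destruct (dir_up D i j) as [k []], (dir_up E i' j') as [k' []].
    exists (k, k'); auto.
  - destruct (dir_inhab D) as [i], (dir_inhab E) as [j]; exact (inhabits (i, j)).
Defined.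

Definition list_directed (A : Type) : directed.
Proof.
  refine (@Directed (list A) (@incl A) (@incl_refl A) (@incl_tran A) _ (inhabits nil)).
  intros l m; exists (l ++ m); split; [apply incl_appl | apply incl_appr]; apply incl_refl.
Defined.

Definition posreal_directed : directed.
Proof.
  refine (@Directed posreal (fun e f => f <= e) Rle_refl _ _ (inhabits (mkposreal 1 Rlt_0_1))).
  - intros i j k ij jk; apply Rle_trans with j; auto.
  - intros [e e0] [f f0]; exists (mkposreal (Rmin e f) (Rmin_pos e f e0 f0)); cbn.
    split; [apply Rmin_l | apply Rmin_r].
Defined.

(** * Compact Hausdorff topology *)

Section Topology.
Context {X : Type} (tX : topology X).

Lemma open_local (U : X -> Prop) :
  (forall x, U x -> exists V, open tX V /\ V x /\ forall v, V v -> U v) -> open tX U.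
Proof.
  intros H.
  replace U with (fun x => exists V, (open tX V /\ forall v, V v -> U v) /\ V x).
  - apply open_union; intros V [HV _]; exact HV.
  - apply pred_ext; intros x; split.
    + intros [V [[_ HV] Vx]]; auto.
    + intros Ux; destruct (H x Ux) as [V [HV [Vx VU]]]; exists V; auto.
Qed.

Lemma open_empty : open tX (fun _ => False).
Proof. apply open_local; intros x []. Qed.

Lemma open_union2 (U V : X -> Prop) :
  open tX U -> open tX V -> open tX (fun x => U x \/ V x).
Proof.
  intros HU HV; apply open_local; intros x [Ux | Vx].
  - exists U; auto.
  - exists V; auto.
Qed.

Lemma open_not_closure (A : X -> Prop) : open tX (fun x => ~ closure tX A x).
Proof.
  apply open_local; intros x Hx.
  apply not_all_ex_not in Hx; destruct Hx as [U HU].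
  apply imply_to_and in HU; destruct HU as [oU HU].
  apply imply_to_and in HU; destruct HU as [Ux HU].
  exists U; split; [exact oU | split; [exact Ux |]].
  intros v Uv cv; apply HU, cv; auto.
Qed.

Lemma closure_sub (A : X -> Prop) x : A x -> closure tX A x.
Proof. intros Ax U _ Ux; exists x; auto. Qed.

Definition nhds (x : X) : directed.
Proof.
  refine (@Directed {U : X -> Prop | open tX U /\ U x}
            (fun U V => forall v, proj1_sig V v -> proj1_sig U v) _ _ _ _).
  - auto.
  - auto.
  - intros [U [oU Ux]] [V [oV Vx]].
    exists (exist _ (fun v => U v /\ V v) (conj (open_inter tX U V oU oV) (conj Ux Vx))).
    cbn; split; tauto.
  - exact (inhabits (exist _ (fun _ => True) (conj (open_full tX) I))).
Defined.

Lemma directed_list (D : directed) (l : list D) :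
  exists k, forall i, In i l -> dir_le D i k.
Proof.
  induction l as [| i l [k Hk]].
  - destruct (dir_inhab D) as [k]; exists k; intros i [].
  - destruct (dir_up D i k) as [k' [Hi Hk']]; exists k'.
    intros j [<- | Hj]; auto.
    apply (dir_trans D) with k; auto.
Qed.

Hypothesis cX : compact tX.

(* Compactness in the form in which it is used throughout: a locally valid
   bound, monotone in a directed parameter, is globally valid. *)
Lemma compact_uniform (D : directed) (P : D -> X -> Prop) :
  (forall i j x, dir_le D i j -> P i x -> P j x) ->
  (forall x, exists i V, open tX V /\ V x /\ forall v, V v -> P i v) ->
  exists i, forall x, P i x.
Proof.
  intros mono loc.
  set (J := {p : D * (X -> Prop) | open tX (snd p) /\ forall v, snd p v -> P (fst p) v}).
  destruct (cX J (fun j => snd (proj1_sig j))) as [l Hl].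
  - intros [p [op Hp]]; exact op.
  - intros x; destruct (loc x) as [i [V [oV [Vx HV]]]].
    exists (exist _ (i, V) (conj oV HV)); exact Vx.
  - destruct (directed_list D (map (fun j => fst (proj1_sig j)) l)) as [k Hk].
    exists k; intros x; destruct (Hl x) as [j [Hj jx]].
    apply mono with (fst (proj1_sig j)).
    + apply Hk; apply (in_map (fun j : J => fst (proj1_sig j))); exact Hj.
    + destruct j as [p [op Hp]]; apply Hp; exact jx.
Qed.

(** If no point were a cluster point, every point would have a neighbourhood avoided by a tail of
    [f]; compactness yields one tail avoiding all of [X], including its own first value. *)
Lemma cluster_point (D : directed) (f : D -> X) :
  exists z, forall U, open tX U -> U z -> forall i, exists j, dir_le D i j /\ U (f j).
Proof.
  apply NNPP; intros H.
  destruct (compact_uniform D (fun i x => forall j, dir_le D i j -> f j <> x)) as [i Hi].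
  - intros i j x ij Hi k jk; apply Hi, (dir_trans D) with j; auto.
  - intros x; apply NNPP; intros Hx; apply H; exists x; intros U oU Ux i.
    apply NNPP; intros Hj; apply Hx; exists i, U; repeat split; auto.
    intros v Uv j ij e; apply Hj; exists j; rewrite e; auto.
  - apply (Hi (f i) i (dir_refl D i) eq_refl).
Qed.

Lemma tube (W : X -> X -> Prop) (O : X -> Prop) x :
  prod_open tX tX W -> open tX O -> (forall v, ~ O v -> W x v) ->
  exists U, open tX U /\ U x /\ forall u v, U u -> ~ O v -> W u v.
Proof.
  intros oW oO HW.
  destruct (compact_uniform (nhds x)
              (fun U v => ~ O v -> forall u, proj1_sig U u -> W u v)) as [[U [oU Ux]] HU].
  - intros U V v UV HU nO u Vu; apply HU; auto.
  - intros v; destruct (classic (O v)) as [Ov | nO].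
    + exists (exist _ (fun _ => True) (conj (open_full tX) I)), O; repeat split; auto.
      intros w Ow nOw; contradiction.
    + destruct (oW x v (HW v nO)) as [U [V [oU [oV [Ux [Vv UV]]]]]].
      exists (exist _ U (conj oU Ux)), V; repeat split; cbn; auto.
  - exists U; repeat split; auto; intros u v Uu nO; apply (HU v); auto.
Qed.

(** Regularity: each point outside [O] is separated from [x], hence lies outside the closure of some
    neighbourhood of [x], and compactness makes that neighbourhood uniform. *)
Lemma closure_in_open (O : X -> Prop) x :
  hausdorff tX -> open tX O -> O x ->
  exists A, open tX A /\ A x /\ forall v, closure tX A v -> O v.
Proof.
  intros hX oO Ox.
  destruct (compact_uniform (nhds x)
              (fun U v => closure tX (proj1_sig U) v -> O v)) as [[U [oU Ux]] HU].
  - intros U V v UV HU cV; apply HU; intros W oW Wv.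
    destruct (cV W oW Wv) as [a [Va Wa]]; exists a; auto.
  - intros v; destruct (classic (O v)) as [Ov | nO].
    + exists (exist _ (fun _ => True) (conj (open_full tX) I)), O; repeat split; auto.
    + destruct (hX x v) as [U [V [oU [oV [Ux [Vv UV]]]]]]; [congruence |].
      exists (exist _ U (conj oU Ux)), V; repeat split; cbn; auto.
      intros w Vw cw; destruct (cw V oV Vw) as [a [Ua Va]]; destruct (UV a Ua Va).
  - exists U; repeat split; auto.
Qed.
End Topology.

(** * Veech pairs from simultaneous return times *)

Section FlowTheory.
Context {T : TopGroup} (X : Flow T).
Local Notation op := (open (fl_top X)).
Local Notation cl := (closure (fl_top X)).
Local Notation inv := (tg_inv T).

Lemma act_invK t (x : X) : act X (inv t) (act X t x) = x.
Proof. rewrite <- act_mul, tg_mulV, act_one; reflexivity. Qed.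

Lemma act_Kinv t (x : X) : act X t (act X (inv t) x) = x.
Proof.
  rewrite <- (act_invK (inv t) (act X t (act X (inv t) x))), (act_invK t).
  apply act_invK.
Qed.

Lemma act_open t (U : X -> Prop) : op U -> op (fun x => U (act X t x)).
Proof.
  intros oU; apply open_local; intros x Ux.
  destruct (act_cont X U oU t x Ux) as [P [V [oP [oV [Pt [Vx PV]]]]]].
  exists V; repeat split; auto.
Qed.

Lemma orbit_hits (U : X -> Prop) x :
  minimal X -> op U -> (exists u, U u) -> exists t, U (act X t x).
Proof.
  intros mX oU [u Uu]; destruct (mX x u U oU Uu) as [a [[t ->] Ua]].
  exists t; exact Ua.
Qed.

Lemma Veech_intro x y z :
  (forall U V, op U -> op V -> U z -> V y ->
     exists t, U (act X t x) /\ V (act X (inv t) z)) -> Veech X x y.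
Proof.
  intros H.
  set (D := prod_directed (nhds (fl_top X) z) (nhds (fl_top X) y)).
  assert (Ht : forall p : D, exists t, proj1_sig (fst p) (act X t x) /\
                                       proj1_sig (snd p) (act X (inv t) z)).
  { intros [[U [oU Uz]] [V [oV Vy]]]; cbn; auto. }
  destruct (choice _ Ht) as [t Ht'].
  exists D, t, z; split; intros U oU Uw.
  - exists (exist _ U (conj oU Uw), exist _ (fun _ => True) (conj (open_full _) I)).
    intros p [Hp _]; apply Hp, Ht'.
  - exists (exist _ (fun _ => True) (conj (open_full _) I), exist _ U (conj oU Uw)).
    intros p [_ Hp]; apply Hp, Ht'.
Qed.

(** With [x_i = x] and [y_i = t_i^-1 z], the net [t_i y_i] is constantly [z]. *)
Lemma Veech_RP x y : Veech X x y -> RP X x y.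
Proof.
  intros [D [t [z [Hx Hy]]]].
  exists D, (fun _ => x), (fun i => act X (inv (t i)) z), t, z; repeat split; auto.
  - intros U oU Ux; destruct (dir_inhab D) as [i]; exists i; auto.
  - intros U oU Uz; destruct (dir_inhab D) as [i]; exists i; intros j _.
    rewrite act_Kinv; exact Uz.
Qed.

(** Equivalently, the whole diagonal lies in the orbit closure of [{x} x B]: one [t] serves both [x]
    and [b]. *)
Definition jointly_hits (x : X) (B : X -> Prop) : Prop :=
  forall A, op A -> (exists a, A a) ->
    exists t b, B b /\ A (act X t x) /\ A (act X t b).

(* The nonempty open sets [A n] satisfy [t n x] in [A n] and
   closure (A (n+1)) included in the intersection of [A n] and [t n (B n)]; any cluster
   point of [t n x] then lies in every [t n (B n)]. *)
Lemma jointly_hits_seq x (B : nat -> X -> Prop) :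
  (forall n, op (B n)) -> (forall n, jointly_hits x (B n)) ->
  exists (t : nat -> tg_car T) (z : X),
    (forall n, B n (act X (inv (t n)) z)) /\
    (forall U, op U -> U z -> forall n, exists m, (n <= m)%nat /\ U (act X (t m) x)).
Proof.
  intros oB HB.
  set (NE := {A : X -> Prop | op A /\ exists a, A a}).
  assert (step : forall n (A : NE), exists p : tg_car T * NE,
     proj1_sig A (act X (fst p) x) /\
     forall v, cl (proj1_sig (snd p)) v ->
       proj1_sig A v /\ B n (act X (inv (fst p)) v)).
  { intros n [A [oA nA]]; cbn.
    destruct (HB n A oA nA) as [t [b [Bb [At Ab]]]].
    destruct (closure_in_open (fl_top X) (fl_compact X)
       (fun v => A v /\ B n (act X (inv t) v)) (act X t b)) as [A' [oA' [A'b HA']]].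
    - apply fl_hausdorff.
    - apply open_inter; auto; apply act_open, oB.
    - rewrite act_invK; auto.
    - exists (t, exist _ A' (conj oA' (ex_intro _ _ A'b))); cbn; auto. }
  destruct (choice (fun (q : nat * NE) (p : tg_car T * NE) =>
     proj1_sig (snd q) (act X (fst p) x) /\
     forall v, cl (proj1_sig (snd p)) v ->
       proj1_sig (snd q) v /\ B (fst q) (act X (inv (fst p)) v))
     (fun q => step (fst q) (snd q))) as [next Hnext].
  set (A := fix A n : NE := match n with
      | O => exist _ (fun _ => True) (conj (open_full _) (ex_intro _ x I))
      | S n => snd (next (n, A n)) end).
  assert (Adec : forall n k v, proj1_sig (A (k + n)%nat) v -> proj1_sig (A n) v).
  { intros n k; induction k as [| k IH]; cbn; auto; intros v Hv.
    apply IH, (Hnext (k + n, A (k + n))%nat), closure_sub; exact Hv. }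
  set (t := fun n => fst (next (n, A n))).
  destruct (cluster_point (fl_top X) (fl_compact X) nat_directed (fun n => act X (t n) x))
    as [z Hz].
  exists t, z; split; [| exact Hz].
  intros n; apply (Hnext (n, A n)); intros U oU Uz.
  (* Starting at [S n] puts [t m x] in [A (S n)], so [z] lies in the closure of [A (S n)], which
     [Hnext] sends into [B n] under the inverse of [t n]. *)
  destruct (Hz U oU Uz (S n)) as [m [Hm Um]].
  exists (act X (t m) x); split; auto.
  change (proj1_sig (A (S n)) (act X (t m) x)).
  apply (Adec (S n) (m - S n)%nat); cbn in Hm.
  replace (m - S n + S n)%nat with m by lia.
  exact (proj1 (Hnext (m, A m))).
Qed.

(** Balls of radius [1 / (n + 1)] make [t_n^-1 z] converge to [y] along the full sequence, so it
    also converges along the indices at which [t_n x] returns near [z]. Of [d], only its balls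
    around [y] matter. *)
Lemma jointly_hits_Veech x y (d : X -> X -> R) :
  (forall V, op V -> V y -> exists eps, 0 < eps /\ forall v, d y v < eps -> V v) ->
  (forall eps, 0 < eps -> op (fun v => d y v < eps)) ->
  (forall eps, 0 < eps -> jointly_hits x (fun v => d y v < eps)) ->
  Veech X x y.
Proof.
  intros Hd od Hh.
  destruct (jointly_hits_seq x (fun n v => d y v < / (INR n + 1))) as [t [z [Hy Hx]]].
  - intros n; apply od, Rinv_0_lt_compat; pose proof (pos_INR n); lra.
  - intros n; apply Hh, Rinv_0_lt_compat; pose proof (pos_INR n); lra.
  - apply Veech_intro with z; intros U V oU oV Uz Vy.
    destruct (Hd V oV Vy) as [eps [e0 He]].
    destruct (archimed_cor1 eps e0) as [n [Hn n0]].
    destruct (Hx U oU Uz n) as [m [Hm Um]].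
    exists (t m); split; auto; apply He.
    eapply Rlt_trans; [apply Hy |]; eapply Rlt_trans; [| exact Hn].
    apply Rinv_lt_contravar; pose proof (lt_INR _ _ n0); pose proof (le_INR _ _ Hm); cbn in *.
    + apply Rmult_lt_0_compat; lra.
    + lra.
Qed.

(** Here [B] stays fixed. The points [t_n^-1 z] are reindexed by the neighbourhoods of [z], so that
    [t_n x] tends to [z]; a cluster point of them is then Veech related to [x] and lies in the
    closure of [B]. *)
Lemma jointly_hits_closure x y :
  (forall B, op B -> B y -> jointly_hits x B) -> cl (Veech X x) y.
Proof.
  intros Hh U oU Uy.
  destruct (closure_in_open (fl_top X) (fl_compact X) U y (fl_hausdorff X) oU Uy)
    as [B [oB [By HB]]].
  destruct (jointly_hits_seq x (fun _ => B)) as [t [z [Hy Hx]]]; auto.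
  assert (Hn : forall P : nhds (fl_top X) z, exists n, proj1_sig P (act X (t n) x)).
  { intros [P [oP Pz]]; destruct (Hx P oP Pz O) as [m [_ Pm]]; exists m; exact Pm. }
  destruct (choice _ Hn) as [n Hn'].
  destruct (cluster_point (fl_top X) (fl_compact X) (nhds (fl_top X) z)
    (fun P => act X (inv (t (n P))) z)) as [y' Hy'].
  exists y'; split.
  - apply Veech_intro with z; intros P V oP oV Pz Vy.
    destruct (Hy' V oV Vy (exist _ P (conj oP Pz))) as [Q [PQ VQ]].
    exists (t (n Q)); split; [apply PQ, Hn' | exact VQ].
  - apply HB; intros V oV Vy.
    destruct (Hy' V oV Vy (exist _ (fun _ => True) (conj (open_full _) I))) as [Q [_ VQ]].
    eexists; split; [| exact VQ]; apply Hy.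
Qed.

(* A saturated closed neighbourhood [D] of [y] missing the class [C] of [x] gives
   the quotient neighbourhood of the diagonal (complement of [C x D]); applying
   equicontinuity to it along [t_i x -> z] keeps [t_i^-1 z] outside [D]. *)
Lemma Veech_S_eq x y : Veech X x y -> S_eq X x y.
Proof.
  intros [I [t [z [Hx Hy]]]] Rl [refl [sym [trans [clR invR]]]] eqR.
  apply NNPP; intros nR.
  assert (oC : op (fun v => ~ Rl x v)).
  { apply open_local; intros v Hv.
    destruct (clR x v Hv) as [U [V [oU [oV [Ux [Vv UV]]]]]].
    exists V; repeat split; auto. }
  destruct (closure_in_open (fl_top X) (fl_compact X) _ y (fl_hausdorff X) oC nR)
    as [A [oA [Ay HA]]].
  (* The saturation of the closure of [A]; it is closed by [tube], since [Rl] is closed. *)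
  set (D := fun b => exists a, cl A a /\ Rl b a).
  assert (oD : op (fun b => ~ D b)).
  { apply open_local; intros b Hb.
    destruct (tube (fl_top X) (fl_compact X) (fun u v => ~ Rl u v)
       (fun v => ~ cl A v) b clR (open_not_closure _ A)) as [U [oU [Ub HU]]].
    - intros v Hv Rv; apply Hv; intros cv; apply Hb; exists v; auto.
    - exists U; repeat split; auto.
      intros u Uu [a [ca Ra]]; apply (HU u a); auto. }
  destruct (eqR (fun a b => ~ Rl x a \/ ~ D b)) as [W' [[W'R W'o] W't]].
  - split.
    + intros a b Rab; apply not_and_or; intros [Rxa [c [Ac Rbc]]].
      apply (HA c Ac); eauto.
    + intros a b [Ha | Hb].
      * exists (fun v => ~ Rl x v), (fun _ => True); repeat split; auto using open_full.
        intros u v Ruv nu Rv; apply nu; eauto.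
      * exists (fun _ => True), (fun v => ~ D v); repeat split; auto using open_full.
        intros u v Ruv nu [c [Ac Rc]]; apply nu; exists c; eauto.
  - destruct (W'o z z (W'R z z (refl z))) as [U [V [[oU _] [_ [Uz [Vz UV]]]]]].
    destruct (Hx U oU Uz) as [i1 H1], (Hy A oA Ay) as [i2 H2].
    destruct (dir_up I i1 i2) as [i [Hi1 Hi2]].
    specialize (H1 i Hi1); specialize (H2 i Hi2).
    destruct (W't (inv (t i)) _ _ (UV _ _ H1 Vz)) as [nx | nD].
    + apply nx; rewrite act_invK; auto.
    + apply nD; exists (act X (inv (t i)) z); split; auto using closure_sub.
Qed.
End FlowTheory.

(** * Invariant measures and their outer content *)

Section InvariantMeasure.
Context {T : TopGroup} (X : Flow T) (mu : (X -> Prop) -> R).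
Local Notation op := (open (fl_top X)).
Hypothesis Hmu : invariant_borel_prob X mu.

Lemma borel_open (U : X -> Prop) : op U -> borel X U.
Proof. intros oU S _ HS; apply HS, oU. Qed.

Lemma borel_not (A : X -> Prop) : borel X A -> borel X (fun x => ~ A x).
Proof. intros HA S HS oS; apply HS, HA; auto. Qed.

Lemma borel_or (A B : X -> Prop) :
  borel X A -> borel X B -> borel X (fun x => A x \/ B x).
Proof.
  intros HA HB S HS oS.
  replace (fun x => A x \/ B x)
    with (fun x => exists n, (match n with O => A | _ => B end) x).
  - apply HS; intros [| n]; [apply HA | apply HB]; auto.
  - apply pred_ext; intros x; split.
    + intros [[| n] Hx]; auto.
    + intros [Hx | Hx]; [exists O | exists 1%nat]; exact Hx.
Qed.

Lemma borel_diff (A B : X -> Prop) :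
  borel X A -> borel X B -> borel X (fun x => A x /\ ~ B x).
Proof.
  intros HA HB.
  replace (fun x => A x /\ ~ B x) with (fun x => ~ (~ A x \/ B x)).
  - apply borel_not, borel_or; auto using borel_not.
  - apply pred_ext; intros x; split; [| tauto].
    intros H; split; [apply NNPP |]; tauto.
Qed.

(** Countable additivity for a sequence of empty sets gives a convergent series with constant term
    [c]. If [c > 0], two consecutive partial sums cannot both be within [c / 2] of the limit. *)
Lemma measure_empty : mu (fun _ => False) = 0.
Proof.
  destruct Hmu as [pos [_ [add _]]].
  assert (bE : borel X (fun _ => False)) by apply borel_open, open_empty.
  set (c := mu (fun _ => False)).
  assert (H : infinite_sum (fun _ => c) c).
  { assert (e : (fun x : X => exists _ : nat, False) = (fun _ => False))
      by (apply pred_ext; firstorder).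
    pose proof (add (fun _ _ => False) (fun _ => bE) (fun _ _ _ _ F _ => F)) as H.
    cbn in H; rewrite e in H; exact H. }
  pose proof (pos _ bE) as c0; fold c in c0.
  apply Rle_antisym; [| exact c0].
  apply Rnot_lt_le; intros c1.
  destruct (H (c / 2)) as [N HN]; [lra |].
  pose proof (HN N (le_n N)) as H1; pose proof (HN (S N) (le_S _ _ (le_n N))) as H2.
  cbn in H2; unfold Rdist in *.
  apply Rabs_def2 in H1; apply Rabs_def2 in H2; lra.
Qed.

Lemma measure_add (A B : X -> Prop) :
  borel X A -> borel X B -> (forall x, A x -> B x -> False) ->
  mu (fun x => A x \/ B x) = mu A + mu B.
Proof.
  intros HA HB AB; destruct Hmu as [pos [_ [add _]]].
  set (F := fun n : nat => match n with O => A | S O => B | _ => fun _ => False end).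
  assert (H : infinite_sum (fun n => mu (F n)) (mu (fun x => exists n, F n x))).
  { apply add.
    - intros [| [| n]]; cbn; auto; apply borel_open, open_empty.
    - intros [| [| n]] [| [| m]] x nm; cbn; try tauto; eauto. }
  replace (fun x => A x \/ B x) with (fun x => exists n, F n x).
  - apply (uniqueness_sum _ _ _ H).
    intros eps e0; exists 1%nat; intros n Hn.
    replace (sum_f_R0 (fun n => mu (F n)) n) with (mu A + mu B).
    + rewrite Rdist_eq; exact e0.
    + destruct n as [| n]; [lia |]; clear Hn; induction n as [| n IH]; [reflexivity |].
      change (sum_f_R0 (fun n => mu (F n)) (S (S n)))
        with (sum_f_R0 (fun n => mu (F n)) (S n) + mu (fun _ => False)).
      rewrite <- IH, measure_empty; ring.
  - apply pred_ext; intros x; split.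
    + intros [[| [| n]] Hx]; cbn in Hx; tauto.
    + intros [Hx | Hx]; [exists O | exists 1%nat]; exact Hx.
Qed.

Lemma measure_le (A B : X -> Prop) :
  borel X A -> borel X B -> (forall x, A x -> B x) -> mu A <= mu B.
Proof.
  intros HA HB AB.
  replace B with (fun x => A x \/ (B x /\ ~ A x)).
  - rewrite measure_add; auto using borel_diff; [| tauto].
    pose proof (proj1 Hmu _ (borel_diff _ _ HB HA)); lra.
  - apply pred_ext; intros x; split; [intros [] | intros; destruct (classic (A x))]; firstorder.
Qed.

Lemma measure_modular (A B : X -> Prop) : op A -> op B ->
  mu (fun x => A x \/ B x) + mu (fun x => A x /\ B x) = mu A + mu B.
Proof.
  intros oA oB.
  assert (bA := borel_open _ oA); assert (bB := borel_open _ oB).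
  assert (bI := borel_open _ (open_inter _ _ _ oA oB)).
  replace (fun x => A x \/ B x) with (fun x => A x \/ (B x /\ ~ A x)).
  - rewrite measure_add; auto using borel_diff; [| tauto].
    replace (mu B) with (mu (fun x => (A x /\ B x) \/ (B x /\ ~ A x))).
    + rewrite measure_add; auto using borel_diff; [ring | tauto].
    + f_equal; apply pred_ext; intros x; destruct (classic (A x)); tauto.
  - apply pred_ext; intros x; destruct (classic (A x)); tauto.
Qed.

(** By minimality and compactness finitely many translates of [U] cover [X]. They all have the
    measure of [U], so a null [U] would make [X] null. *)
Lemma measure_pos (U : X -> Prop) :
  minimal X -> op U -> (exists u, U u) -> 0 < mu U.
Proof.
  intros mX oU nU; apply Rnot_le_lt; intros Hle.
  destruct (compact_uniform (fl_top X) (fl_compact X) (list_directed (tg_car T))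
     (fun l x => exists t, In t l /\ U (act X t x))) as [l Hl].
  - intros i j x ij [t [Ht Ut]]; exists t; auto.
  - intros x; destruct (orbit_hits X U x mX oU nU) as [t Ut].
    exists (t :: nil), (fun x => U (act X t x)); repeat split; auto using act_open.
    intros v Uv; exists t; cbn; auto.
  - assert (H : op (fun x => exists t, In t l /\ U (act X t x)) /\
                mu (fun x => exists t, In t l /\ U (act X t x)) <= 0).
    { clear Hl; induction l as [| t l [oI IH]].
      - replace (fun x => exists t, In t nil /\ U (act X t x)) with (fun _ : X => False)
          by (apply pred_ext; firstorder).
        rewrite measure_empty; split; [apply open_empty | lra].
      - set (E := fun x => exists t, In t l /\ U (act X t x)) in *.
        replace (fun x => exists s, In s (t :: l) /\ U (act X s x))
          with (fun x => U (act X t x) \/ E x).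
        + split; [apply open_union2; auto using act_open |].
          pose proof (measure_modular _ _ (act_open X t U oU) oI) as M.
          pose proof (proj1 Hmu _ (borel_open _ (open_inter _ _ _ (act_open X t U oU) oI))).
          pose proof (proj2 (proj2 (proj2 Hmu)) t U (borel_open _ oU)) as I.
          cbn in *; rewrite I in M; lra.
        + apply pred_ext; intros x; unfold E; split.
          * intros [Ux | [s [Hs Us]]]; [exists t | exists s]; cbn; auto.
          * intros [s [[<- | Hs] Us]]; [left | right; exists s]; auto. }
    destruct H as [_ H].
    replace (fun x => exists t, In t l /\ U (act X t x)) with (fun _ : X => True) in H.
    + rewrite (proj1 (proj2 Hmu)) in H; lra.
    + apply pred_ext; firstorder.
Qed.

(* [mu] is not assumed regular; the arguments only use the submodular content
   that its values on open sets induce on arbitrary sets. *)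
Definition outer_content (K : X -> Prop) : R :=
  epsilon (inhabits 0) (fun r =>
    (forall O, op O -> (forall x, K x -> O x) -> r <= mu O) /\
    (forall eps, 0 < eps -> exists O, op O /\ (forall x, K x -> O x) /\ mu O < r + eps)).

Lemma outer_content_spec (K : X -> Prop) :
  (forall O, op O -> (forall x, K x -> O x) -> outer_content K <= mu O) /\
  (forall eps, 0 < eps ->
     exists O, op O /\ (forall x, K x -> O x) /\ mu O < outer_content K + eps).
Proof.
  unfold outer_content; apply epsilon_spec.
  (* The infimum of [mu O] is obtained as minus the supremum of [- mu O]. *)
  destruct (completeness (fun r => exists O, op O /\ (forall x, K x -> O x) /\ r = - mu O))
    as [s [sub slub]].
  - exists 0; intros r [O [oO [_ ->]]].
    pose proof (proj1 Hmu _ (borel_open _ oO)); lra.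
  - exists (- mu (fun _ => True)), (fun _ => True); auto using open_full.
  - exists (- s); split.
    + intros O oO KO; enough (- mu O <= s) by lra; apply sub; exists O; auto.
    + intros eps e0; apply NNPP; intros H.
      enough (s <= s - eps) by lra; apply slub; intros r [O [oO [KO ->]]].
      apply Rnot_lt_le; intros Hlt; apply H; exists O; repeat split; auto; lra.
Qed.

Lemma outer_content_le (K : X -> Prop) O :
  op O -> (forall x, K x -> O x) -> outer_content K <= mu O.
Proof. apply outer_content_spec. Qed.

Lemma outer_content_approx (K : X -> Prop) eps : 0 < eps ->
  exists O, op O /\ (forall x, K x -> O x) /\ mu O < outer_content K + eps.
Proof. apply outer_content_spec. Qed.

Lemma outer_content_mono (K L : X -> Prop) :
  (forall x, K x -> L x) -> outer_content K <= outer_content L.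
Proof.
  intros KL; apply le_epsilon; intros eps e0.
  destruct (outer_content_approx L eps e0) as [O [oO [LO HO]]].
  apply Rle_trans with (mu O); [apply outer_content_le; auto | lra].
Qed.

(** Open sets within [eps / 2] of optimal for [K] and [L] have a union and an intersection covering
    those of [K] and [L], and [mu] is modular on open sets. *)
Lemma outer_content_submodular (K L : X -> Prop) :
  outer_content (fun x => K x \/ L x) + outer_content (fun x => K x /\ L x)
  <= outer_content K + outer_content L.
Proof.
  apply le_epsilon; intros eps e0.
  destruct (outer_content_approx K (eps / 2)) as [O [oO [KO HO]]]; [lra |].
  destruct (outer_content_approx L (eps / 2)) as [P [oP [LP HP]]]; [lra |].
  pose proof (measure_modular O P oO oP).
  pose proof (outer_content_le (fun x => K x \/ L x) (fun x => O x \/ P x)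
                (open_union2 _ _ _ oO oP) ltac:(firstorder)).
  pose proof (outer_content_le (fun x => K x /\ L x) (fun x => O x /\ P x)
                (open_inter _ _ _ oO oP) ltac:(firstorder)).
  lra.
Qed.

(** One inequality for all [t] and [K] suffices: applied to the inverse of [t] it gives the
    other. *)
Lemma outer_content_act t (K : X -> Prop) :
  outer_content (fun x => K (act X t x)) = outer_content K.
Proof.
  assert (H : forall t K, outer_content (fun x => K (act X t x)) <= outer_content K).
  { clear t K; intros t K; apply le_epsilon; intros eps e0.
    destruct (outer_content_approx K eps e0) as [O [oO [KO HO]]].
    apply Rle_trans with (mu (fun x => O (act X t x))).
    - apply outer_content_le; auto using act_open.
    - rewrite (proj2 (proj2 (proj2 Hmu)) t O (borel_open _ oO)); lra. }
  apply Rle_antisym; [apply H |].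
  replace K with (fun x => K (act X t (act X (tg_inv T t) x))) at 1.
  - apply (H _ (fun x => K (act X t x))).
  - apply pred_ext; intros x; rewrite act_Kinv; tauto.
Qed.

(** Otherwise some nonempty open [A] has its closure inside [B] minus [K]. Deleting that closure
    from an open cover of [B] and [K] still covers [K] and saves at least [mu A > 0]; a cover
    optimal up to [mu A] gives the contradiction. *)
Lemma outer_content_open_subset (B K : X -> Prop) :
  minimal X -> op B -> op (fun x => ~ K x) ->
  outer_content (fun x => B x \/ K x) <= outer_content K -> forall b, B b -> K b.
Proof.
  intros mX oB oK Hle b Bb; apply NNPP; intros nK.
  destruct (closure_in_open (fl_top X) (fl_compact X) (fun x => B x /\ ~ K x) b)
    as [A [oA [Ab HA]]]; auto using fl_hausdorff, open_inter.
  pose proof (measure_pos A mX oA (ex_intro _ b Ab)) as A0.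
  destruct (outer_content_approx (fun x => B x \/ K x) (mu A)) as [O [oO [KO HO]]]; auto.
  set (P := fun x => O x /\ ~ closure (fl_top X) A x).
  assert (oP : op P) by (apply open_inter; auto using open_not_closure).
  assert (outer_content K <= mu P).
  { apply outer_content_le; auto; intros x Kx; split; [auto |].
    intros cx; apply (HA x cx); exact Kx. }
  assert (mu (fun x => A x \/ P x) <= mu O).
  { apply measure_le; auto using borel_open, borel_or.
    intros x [Ax | [Ox _]]; auto; apply KO; left; apply HA, closure_sub, Ax. }
  rewrite measure_add in H0; auto using borel_open.
  - lra.
  - intros x Ax [_ nx]; apply nx, closure_sub, Ax.
Qed.
End InvariantMeasure.

(** * Continuous invariant pseudometrics and equicontinuous quotients *)

(** Nonnegativity follows from the other axioms, and the last clause with the triangle inequality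
    makes all balls open. *)
Definition invariant_pseudometric {T : TopGroup} (X : Flow T) (d : X -> X -> R) : Prop :=
  (forall x, d x x = 0) /\ (forall x y, d x y = d y x) /\
  (forall x y z, d x z <= d x y + d y z) /\
  (forall t x y, d (act X t x) (act X t y) = d x y) /\
  (forall x eps, 0 < eps -> exists U, open (fl_top X) U /\ U x /\ forall v, U v -> d x v < eps).

Section Pseudometric.
Context {T : TopGroup} (X : Flow T) (d : X -> X -> R).
Local Notation op := (open (fl_top X)).
Hypothesis Hd : invariant_pseudometric X d.

Lemma ipm_refl x : d x x = 0.
Proof. apply Hd. Qed.

Lemma ipm_sym x y : d x y = d y x.
Proof. apply Hd. Qed.

Lemma ipm_triangle x y z : d x z <= d x y + d y z.
Proof. apply Hd. Qed.

Lemma ipm_act t x y : d (act X t x) (act X t y) = d x y.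
Proof. apply Hd. Qed.

Lemma ipm_nonneg x y : 0 <= d x y.
Proof.
  pose proof (ipm_triangle x y x) as H; rewrite ipm_refl, (ipm_sym y x) in H; lra.
Qed.

Lemma ipm_ball_open x eps : op (fun v => d x v < eps).
Proof.
  apply open_local; intros v Hv.
  destruct (proj2 (proj2 (proj2 (proj2 Hd))) v (eps - d x v)) as [U [oU [Uv HU]]]; [lra |].
  exists U; repeat split; auto; intros w Uw.
  pose proof (HU w Uw); pose proof (ipm_triangle x v w); lra.
Qed.

(** Invariance gives [d x_i y_i = d (t_i x_i) (t_i y_i)], which tends to [d z z = 0]; four errors of
    [eps / 4] add up to [eps]. *)
Lemma RP_ipm_zero x y : RP X x y -> d x y = 0.
Proof.
  intros [D [xi [yi [t [z [Hx [Hy [Hxz Hyz]]]]]]]].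
  apply Rle_antisym; [| apply ipm_nonneg].
  apply le_epsilon; intros eps e0; rewrite Rplus_0_l.
  assert (b : forall w, d w w < eps / 4) by (intros; rewrite ipm_refl; lra).
  destruct (Hx _ (ipm_ball_open x (eps / 4)) (b x)) as [i1 H1].
  destruct (Hy _ (ipm_ball_open y (eps / 4)) (b y)) as [i2 H2].
  destruct (Hxz _ (ipm_ball_open z (eps / 4)) (b z)) as [i3 H3].
  destruct (Hyz _ (ipm_ball_open z (eps / 4)) (b z)) as [i4 H4].
  destruct (directed_list D (i1 :: i2 :: i3 :: i4 :: nil)) as [i Hi]; cbn in Hi.
  specialize (H1 i (Hi i1 ltac:(tauto))); specialize (H2 i (Hi i2 ltac:(tauto))).
  specialize (H3 i (Hi i3 ltac:(tauto))); specialize (H4 i (Hi i4 ltac:(tauto))); cbn in *.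
  pose proof (ipm_triangle x (xi i) y); pose proof (ipm_triangle (xi i) (yi i) y).
  pose proof (ipm_triangle (act X (t i) (xi i)) z (act X (t i) (yi i))) as H5.
  rewrite ipm_act, (ipm_sym _ z) in H5; rewrite (ipm_sym y) in H2; lra.
Qed.

(** This says that [d] induces the quotient topology. A point [v] outside the saturated [U] has
    [d x v > 0], and the balls of half that radius around [x] and [v] are disjoint; compactness
    gives a common radius. *)
Lemma ipm_saturated_ball (U : X -> Prop) x :
  sat_open X (fun u v => d u v = 0) U -> U x ->
  exists eps, 0 < eps /\ forall v, d x v < eps -> U v.
Proof.
  intros [oU sU] Ux.
  destruct (compact_uniform (fl_top X) (fl_compact X) posreal_directed
     (fun (e : posreal) v => d x v < e -> U v)) as [[e e0] He].
  - intros i j v ij Hi Hj; apply Hi; cbn in ij; lra.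
  - intros v; destruct (classic (U v)) as [Uv | nU].
    + exists (mkposreal 1 Rlt_0_1), U; auto.
    + assert (dv : 0 < d x v / 2).
      { pose proof (ipm_nonneg x v); destruct (Req_dec (d x v) 0) as [e | n]; [| lra].
        destruct nU; apply (sU x v e Ux). }
      exists (mkposreal _ dv), (fun w => d v w < d x v / 2); repeat split.
      * apply ipm_ball_open.
      * rewrite ipm_refl; exact dv.
      * cbn; intros w vw xw; pose proof (ipm_triangle x w v) as H.
        rewrite (ipm_sym w v) in H; lra.
  - exists e; split; [exact e0 | exact He].
Qed.

Lemma ipm_closed_invariant_equivalence :
  closed_invariant_equivalence X (fun u v => d u v = 0).
Proof.
  repeat split.
  - apply ipm_refl.
  - intros u v; rewrite ipm_sym; auto.
  - intros u v w uv vw; pose proof (ipm_nonneg u w); pose proof (ipm_triangle u v w); lra.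
  - intros a b nab; pose proof (ipm_nonneg a b).
    exists (fun u => d a u < d a b / 2), (fun v => d b v < d a b / 2).
    rewrite !ipm_refl; repeat split; try apply ipm_ball_open; try lra.
    intros u v au bv uv; pose proof (ipm_triangle a u b); pose proof (ipm_triangle u v b).
    rewrite (ipm_sym v b) in *; lra.
  - intros t u v; rewrite ipm_act; auto.
Qed.

(** The group acts by isometries of the quotient metric, so a uniform radius [e] for [W] works for
    all [t] at once. *)
Lemma ipm_quotient_equicontinuous : quotient_equicontinuous X (fun u v => d u v = 0).
Proof.
  intros W [WR Wo].
  destruct (compact_uniform (fl_top X) (fl_compact X) posreal_directed
     (fun (e : posreal) u => forall v, d u v < e -> W u v)) as [[e e0] He].
  - intros i j u ij Hi v Hv; apply Hi; cbn in ij; lra.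
  - intros x; destruct (Wo x x (WR x x (ipm_refl x))) as [U [V [sU [sV [Ux [Vx UV]]]]]].
    destruct (ipm_saturated_ball U x sU Ux) as [e [e0 He]].
    destruct (ipm_saturated_ball V x sV Vx) as [f [f0 Hf]].
    (* Halving leaves room for [d x v <= d x u + d u v]. *)
    assert (g0 : 0 < Rmin e f / 2) by (pose proof (Rmin_pos e f e0 f0); lra).
    exists (mkposreal _ g0), (fun u => d x u < Rmin e f / 2); repeat split.
    + apply ipm_ball_open.
    + rewrite ipm_refl; exact g0.
    + cbn; intros u xu v uv; pose proof (ipm_triangle x u v).
      pose proof (Rmin_l e f); pose proof (Rmin_r e f).
      apply UV; [apply He | apply Hf]; lra.
  - cbn in He; exists (fun u v => d u v < e); repeat split.
    + intros u v ->; exact e0.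
    + assert (sat : forall a r, sat_open X (fun u v => d u v = 0) (fun u => d a u < r)).
      { intros a r; split; [apply ipm_ball_open |].
        intros u v uv au; pose proof (ipm_triangle a u v); lra. }
      intros a b ab.
      exists (fun u => d a u < (e - d a b) / 2), (fun v => d b v < (e - d a b) / 2).
      rewrite !ipm_refl; repeat split; try apply sat; try lra.
      intros u v au bv; pose proof (ipm_triangle u a v); pose proof (ipm_triangle a b v).
      rewrite (ipm_sym u a) in *; lra.
    + intros t u v uv; apply He; rewrite ipm_act; exact uv.
Qed.

Lemma S_eq_ipm_zero x y : S_eq X x y -> d x y = 0.
Proof.
  intros H; apply (H (fun u v => d u v = 0)).
  - apply ipm_closed_invariant_equivalence.
  - apply ipm_quotient_equicontinuous.
Qed.
End Pseudometric.

(** * The pseudometric of a closed invariant relation *)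

Section FiberMetric.
Context {T : TopGroup} (X : Flow T) (mu : (X -> Prop) -> R) (N : X -> X -> Prop).
Local Notation op := (open (fl_top X)).
Hypothesis mX : minimal X.
Hypothesis Hmu : invariant_borel_prob X mu.
Hypothesis closedN : prod_open (fl_top X) (fl_top X) (fun u v => ~ N u v).
Hypothesis actN : forall t u v, N u v <-> N (act X t u) (act X t v).

(** Upper semicontinuity of the fibers: [tube] applied to the open complement of [N]. *)
Lemma fiber_usc u (O : X -> Prop) : op O -> (forall v, N u v -> O v) ->
  exists U, op U /\ U u /\ forall w, U w -> forall v, N w v -> O v.
Proof.
  intros oO NO.
  destruct (tube (fl_top X) (fl_compact X) _ O u closedN oO) as [U [oU [Uu HU]]].
  - intros v nO Nv; auto.
  - exists U; repeat split; auto; intros w Uw v Nv; apply NNPP; intros nO.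
    apply (HU w v Uw nO Nv).
Qed.

Lemma fiber_act t u : N u = fun v => N (act X t u) (act X t v).
Proof. apply pred_ext; intros v; apply actN. Qed.

(* An invariant upper semicontinuous function on a minimal flow is constant. *)
Lemma fiber_content_const u v :
  outer_content X mu (N u) = outer_content X mu (N v).
Proof.
  assert (H : forall u v, outer_content X mu (N u) <= outer_content X mu (N v)).
  { clear u v; intros u v; apply le_epsilon; intros eps e0.
    destruct (outer_content_approx X mu Hmu (N v) eps e0) as [O [oO [NO HO]]].
    destruct (fiber_usc v O oO NO) as [V [oV [Vv HV]]].
    destruct (orbit_hits X V u mX oV (ex_intro _ v Vv)) as [t Vt].
    rewrite (fiber_act t u), (outer_content_act X mu Hmu t (N (act X t u))).
    apply Rle_trans with (mu O); [apply outer_content_le; auto; apply HV, Vt | lra]. }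
  apply Rle_antisym; apply H.
Qed.

(* On regular measures and closed sets this is half of the measure of the
   symmetric difference of the fibers. *)
Definition fiber_dist (u v : X) : R :=
  outer_content X mu (fun w => N u w \/ N v w) - outer_content X mu (N u).

(** The triangle inequality is submodularity for [N x] joined with [N y] and [N y] joined with
    [N z], whose intersection contains [N y]. Symmetry uses that all fibers have equal content, and
    continuity comes from upper semicontinuity. *)
Lemma fiber_dist_ipm : invariant_pseudometric X fiber_dist.
Proof.
  unfold fiber_dist; split; [| split; [| split; [| split]]].
  - intros x; replace (fun w => N x w \/ N x w) with (N x); [ring |].
    apply pred_ext; tauto.
  - intros x y; rewrite (fiber_content_const y x).
    do 2 f_equal; apply pred_ext; tauto.
  - intros x y z; rewrite (fiber_content_const y x).
    pose proof (outer_content_submodular X mu Hmu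
      (fun w => N x w \/ N y w) (fun w => N y w \/ N z w)) as S; cbn in S.
    pose proof (outer_content_mono X mu Hmu (fun w => N x w \/ N z w)
      (fun w => (N x w \/ N y w) \/ N y w \/ N z w) ltac:(cbn; intros; tauto)).
    pose proof (outer_content_mono X mu Hmu (N y)
      (fun w => (N x w \/ N y w) /\ (N y w \/ N z w)) ltac:(cbn; intros; tauto)) as Hy.
    rewrite (fiber_content_const y x) in Hy; lra.
  - intros t x y; rewrite (fiber_content_const (act X t x) x).
    rewrite <- (outer_content_act X mu Hmu t (fun w => N (act X t x) w \/ N (act X t y) w)).
    do 2 f_equal; apply pred_ext; intros w; rewrite (actN t x), (actN t y); tauto.
  - intros x eps e0.
    destruct (outer_content_approx X mu Hmu (N x) eps e0) as [O [oO [NO HO]]].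
    destruct (fiber_usc x O oO NO) as [V [oV [Vv HV]]].
    exists V; repeat split; auto; intros v Vv'.
    pose proof (outer_content_le X mu Hmu (fun w => N x w \/ N v w) O oO) as H.
    enough (outer_content X mu (fun w => N x w \/ N v w) <= mu O) by lra.
    apply H; intros w [Nw | Nw]; [auto | apply (HV v Vv' w Nw)].
Qed.

(** At distance zero the union of [N u] and [N v] has the content of [N v] alone, so adding [B] to
    [N v] does not raise its content. *)
Lemma fiber_dist_zero_open u v (B : X -> Prop) :
  fiber_dist u v = 0 -> op B -> (forall b, B b -> N u b) -> forall b, B b -> N v b.
Proof.
  unfold fiber_dist; rewrite (fiber_content_const u v); intros d0 oB BN.
  apply (outer_content_open_subset X mu Hmu B (N v) mX oB).
  - apply open_local; intros w Hw.
    destruct (closedN v w Hw) as [U [V [oU [oV [Uv [Vw UV]]]]]].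
    exists V; repeat split; auto.
  - pose proof (outer_content_mono X mu Hmu (fun w => B w \/ N v w)
      (fun w => N u w \/ N v w) ltac:(firstorder)); lra.
Qed.
End FiberMetric.

(** * From vanishing pseudometrics to the theorem *)

Definition orbit_closure_of_slice {T : TopGroup} (X : Flow T) (x : X) (B : X -> Prop)
  (u v : X) : Prop :=
  forall U V, open (fl_top X) U -> open (fl_top X) V -> U u -> V v ->
    exists t b, B b /\ U (act X t x) /\ V (act X t b).

Lemma ipm_zero_jointly_hits {T : TopGroup} (X : Flow T) mu x y (B : X -> Prop) :
  minimal X -> invariant_borel_prob X mu ->
  (forall d, invariant_pseudometric X d -> d x y = 0) ->
  open (fl_top X) B -> B y -> jointly_hits X x B.
Proof.
  intros mX Hmu Hd oB By.
  set (N := orbit_closure_of_slice X x B).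
  assert (closedN : prod_open (fl_top X) (fl_top X) (fun u v => ~ N u v)).
  { intros u v nN; apply NNPP; intros H; apply nN; intros U V oU oV Uu Vv.
    apply NNPP; intros Ht; apply H; exists U, V; do 4 (split; [assumption |]).
    intros u' v' Uu' Vv' HN; apply Ht, (HN U V oU oV Uu' Vv'). }
  assert (actN1 : forall t u v, N u v -> N (act X t u) (act X t v)).
  { intros t u v HN U V oU oV Uu Vv.
    destruct (HN _ _ (act_open X t U oU) (act_open X t V oV) Uu Vv) as [s [b [Bb [Us Vs]]]].
    exists (tg_mul T t s), b; rewrite !act_mul; auto. }
  assert (actN : forall t u v, N u v <-> N (act X t u) (act X t v)).
  { intros t u v; split; [apply actN1 |]; intros HN.
    apply (actN1 (tg_inv T t)) in HN; rewrite !act_invK in HN; exact HN. }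
  assert (HN : N y y).
  { apply (fiber_dist_zero_open X mu N mX Hmu closedN actN x y B); auto.
    - apply Hd, fiber_dist_ipm; auto.
    (* The identity of the group shows that [B] lies in the fiber [N x]. *)
    - intros b Bb U V oU oV Ux Vb; exists (tg_one T), b; rewrite !act_one; auto. }
  (* Since [(y, y)] is in the invariant [N], so is [(s y, s y)], and [s y] can be moved into any
     nonempty open [A]. *)
  intros A oA nA; destruct (orbit_hits X A y mX oA nA) as [s As].
  apply (proj1 (actN s y y) HN); auto.
Qed.

Theorem mainTheorem7 (T : TopGroup) (X : Flow T) :
  minimal X ->
  (exists mu : (X -> Prop) -> R, invariant_borel_prob X mu) ->
  (forall x : X,
     (forall y, Veech X x y -> RP X x y) /\
     (forall y, RP X x y -> closure (fl_top X) (Veech X x) y)) /\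
  (metrizable (fl_top X) ->
     (forall x y : X, Veech X x y <-> RP X x y) /\
     (forall x y : X, Veech X x y <-> S_eq X x y)).
Proof.
  intros mX [mu Hmu]; split.
  - intros x; split; [apply Veech_RP |].
    intros y Hxy; apply jointly_hits_closure; intros B oB By.
    apply (ipm_zero_jointly_hits X mu x y); auto.
    intros d Hd; apply RP_ipm_zero; auto.
  - intros [r [r0 [rE [rS [rT rO]]]]].
    (* Both [RP] and [S_eq] make every continuous invariant pseudometric vanish, so one implication
       settles both converses. *)
    assert (H : forall x y, (forall d, invariant_pseudometric X d -> d x y = 0) ->
                  Veech X x y).
    { intros x y Hd.
      assert (ball : forall eps, open (fl_top X) (fun v => r y v < eps)).
      { intros eps; apply rO; intros v Hv; exists (eps - r y v); split; [lra |].
        intros w vw; pose proof (rT y v w); lra. }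
      apply (jointly_hits_Veech X x y r).
      - intros V oV Vy; apply rO; auto.
      - auto.
      - intros eps e0; apply (ipm_zero_jointly_hits X mu x y); auto.
        rewrite (proj2 (rE y y) eq_refl); exact e0. }
    split; intros x y; split.
    + apply Veech_RP.
    + intros Hxy; apply H; intros d Hd; apply RP_ipm_zero; auto.
    + apply Veech_S_eq.
    + intros Hxy; apply H; intros d Hd; apply (S_eq_ipm_zero X d Hd); auto.
Qed.
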